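(* Let $\mathbb K$ be a field of characteristic $0$, let $R=\mathbb K[x_1,\ldots,x_k]$, and let $\Sigma=(\ell_1,\ldots,\ell_n)$, $n\ge 1$, be any collection of (nonzero) linear forms in $R$, some possibly proportional. Then the ideal $I_{n-1}(\Sigma)$ has linear graded free resolution.
   Context: $R$ has the standard grading. $\Sigma$ is a collection with repetitions allowed, $|\Sigma|=n$. For $1\le a\le n$, $I_a(\Sigma)$ is the ideal of $R$ generated by all products $\ell_{i_1}\cdots\ell_{i_a}$ with $1\le i_1<\cdots<i_a\le n$; by convention $I_0(\Sigma)=R$. A homogeneous ideal $I\subset R$ generated in degree $d$ has linear graded free resolution if there is a graded free resolution of the form $0\rightarrow R^{n_{b+1}}(-(d+b))\rightarrow\cdots\rightarrow R^{n_2}(-(d+1))\rightarrow R^{n_1}(-d)\rightarrow R\rightarrow R/I\rightarrow 0$ for some positive integer $b$ (the ranks $n_i\ge 0$ are allowed to vanish, so that principal ideals qualify). *)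

(* Defs.v *)
From HB Require Import structures.
From mathcomp Require Import all_boot all_order all_algebra.
From mathcomp Require Export mpoly.
Set Implicit Arguments. Unset Strict Implicit. Unset Printing Implicit Defensive.
Import GRing.Theory.
Local Open Scope ring_scope.

(* Ideals are Prop-valued predicates: membership need not be decidable. *)
Definition ideal_gen (R : comNzRingType) (S : R -> Prop) (f : R) : Prop :=
  exists (m : nat) (c g : 'I_m -> R),
    (forall i, S (g i)) /\ f = \sum_(i < m) c i * g i.

(* The a-element subsets A of 'I_n play the role of i_1 < ... < i_a; for a = 0
   the only generator is the empty product 1, so the ideal is the whole ring. *)
Definition fold_product_ideal (R : comNzRingType) (n : nat)
    (l : n.-tuple R) (a : nat) : R -> Prop :=
  ideal_gen (fun g => exists2 A : {set 'I_n},
                        #|A| = a & g = \prod_(i in A) tnth l i).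

Section GradedResolutions.
Variables (K : fieldType) (k : nat).
Local Notation R := {mpoly K[k]}.

Definition generated_in_degree (d : nat) (I : R -> Prop) : Prop :=
  exists S : R -> Prop,
    (forall g, S g -> g \is d.-homog) /\ (forall f, I f <-> ideal_gen S f).

(* v lies in the degree e component of R^m(-s), i.e. all the entries of v are
   in R_(e - s), which is 0 when e < s.  Since s >= 0, the components of
   negative degree are all 0, so e may range over nat. *)
Definition twisted_homog (m s e : nat) (v : 'rV[R]_m) : Prop :=
  if (s <= e)%N then forall j, v 0 j \is (e - s)%N.-homog else v = 0.

Definition graded_map (U V : Type) (degU : nat -> U -> Prop)
    (degV : nat -> V -> Prop) (f : U -> V) : Prop :=
  forall e u, degU e u -> degV e (f u).

(* I is generated in degree d and there is an exact complex of graded maps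
     0 -> F_b -> ... -> F_1 -> F_0 -> R -> R/I -> 0,  F_i = R^(r i)(-(d + i)),
   where eps : F_0 -> R and phi i : F_(i+1) -> F_i.  Thus r i is n_(i+1), and
   F_i = 0 for i > b, so that the last condition says for i.+1 = b that the
   map F_b -> F_(b-1) is injective, and is void for i >= b.
   Exactness at R says that the image of eps is I. *)
Definition has_linear_resolution (d : nat) (I : R -> Prop) : Prop :=
  generated_in_degree d I /\
  exists (b : nat) (r : nat -> nat)
         (eps : {linear 'rV[R]_(r 0%N) -> R^o})
         (phi : forall i, {linear 'rV[R]_(r i.+1) -> 'rV[R]_(r i)}),
    (0 < b)%N /\
    (forall i, (b < i)%N -> r i = 0%N) /\
    graded_map (@twisted_homog (r 0%N) d) (fun e (f : R) => f \is e.-homog) eps /\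
    (forall i, graded_map (@twisted_homog (r i.+1) (d + i.+1))
                          (@twisted_homog (r i) (d + i)) (phi i)) /\
    (forall f : R, I f <-> exists u, eps u = f) /\
    (forall v, eps v = 0 <-> exists u, phi 0%N u = v) /\
    (forall i v, phi i v = 0 <-> exists u, phi i.+1 u = v).

End GradedResolutions.

(* Main.v *)
Require Import Defs.
From HB Require Import structures.
From mathcomp Require Import all_boot all_order all_algebra.
From mathcomp Require Import mpoly.
From mathcomp Require Import ring.
Import GRing.Theory.
Local Open Scope ring_scope.

(** Call two of the forms associated when they are proportional.  Choose a
representative of each class, let [p_0, ..., p_m] be the chosen forms and [Q]
the product of all the other members of the collection, counted with
multiplicity.  If one form divides another, then the cofactors they leave in
the total product divide each other the other way round, so the ideal is
already generated by the cofactors of the representatives, that is by the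
[g_a = Q * \prod_(b != a) p_b].

A linear form is a prime element: a linear substitution that eliminates one
variable is a ring endomorphism whose kernel is the principal ideal of the form
([linear_form_kernel]), and the polynomial ring is a domain.  Since [p_a]
divides no other [p_b], a syzygy [\sum_a v_a g_a = 0], reduced modulo [p_a]
after cancelling [Q], forces [v_a = b_a p_a]; what remains is
[(\sum_a b_a) * Q * \prod_a p_a = 0], that is [\sum_a b_a = 0]
([syzygies_of_cofactors]).  The syzygies are thus the free module of the
vectors [(b_a p_a)] with [\sum_a b_a = 0], which gives the Hilbert-Burch
resolution
<<
   0 -> R^m(-n) -> R^(m+1)(-(n-1)) -> R
>>
whose first map has linear entries ([hilbert_burch_linear_resolution]). *)

(** * Linear forms are prime *)

Section LinearForms.
Context {K : fieldType} {k : nat}.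
Implicit Types l f : {mpoly K[k]}.

Lemma linear_formE l : l \is 1.-homog -> l = \sum_i l@_U_(i) *: 'X_i.
Proof.
move=> hl; apply/mpolyP=> m; rewrite raddf_sum /=.
have [/eqP/mdeg1P[i /eqP->]|m1] := eqVneq (mdeg m) 1%N.
  rewrite (bigD1 i) //= mcoeffZ mcoeffX eqxx mulr1 big1 ?addr0 // => j ji.
  by rewrite mcoeffZ mcoeffX eq_mnm1 (negPf ji) mulr0.
rewrite (dhomog_nemf_coeff hl m1) big1 // => i _.
rewrite mcoeffZ mcoeffX; case: eqP => [e|]; last by rewrite mulr0.
by rewrite -e mdeg1 eqxx in m1.
Qed.

(** A substitution that is trivial on the variables modulo [l] is trivial
    modulo [l]. *)
Lemma comp_mpoly_congr l (t : k.-tuple {mpoly K[k]}) :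
  (forall i, exists c, 'X_i - tnth t i = c * l) ->
  forall f, exists c, f - (f \mPo t) = c * l.
Proof.
move=> tE; elim/mpolyind => [|c m f _ _ [d ed]].
  by exists 0; rewrite comp_mpoly0 subrr mul0r.
have [d' ed'] : exists d', 'X_[m] - ('X_[m] \mPo t) = d' * l.
  rewrite comp_mpolyX mpolyXE_id.
  apply: (big_rec2 (fun x y => exists d', x - y = d' * l)).
    by exists 0; rewrite subrr mul0r.
  move=> i x y _ [u eu].
  have [v ev] : exists v, 'X_i ^+ m i - tnth t i ^+ m i = v * l.
    have [w ew] := tE i.
    by exists (w * \sum_(j < m i) 'X_i ^+ ((m i).-1 - j) * tnth t i ^+ j);
      rewrite subrXX ew mulrAC.
  exists ('X_i ^+ m i * u + v * y).
  by rewrite mulrDl -[_ * u * l]mulrA -eu [v * y * l]mulrAC -ev; ring.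
exists (c *: d' + d).
rewrite comp_mpolyD comp_mpolyZ mulrDl -ed -scalerAl -ed' scalerBr.
by rewrite opprD addrACA.
Qed.

(** Solving [l = 0] for a variable ['X_p] that occurs in [l] is a substitution
    which kills [l] and is trivial modulo [l]. *)
Lemma linear_form_kernel l :
  l \is 1.-homog -> l != 0 ->
  exists s : {rmorphism {mpoly K[k]} -> {mpoly K[k]}},
    forall f, s f = 0 <-> exists c, f = c * l.
Proof.
move=> hl l0.
have [p lp] : exists p, l@_U_(p) != 0.
  have /eqP/mdeg1P[p /eqP ep] := dhomog_mf hl (mlead_supp l0).
  by exists p; rewrite -ep mleadc_eq0.
pose t := [tuple 'X_i - (i == p)%:R *: ((l@_U_(p))^-1 *: l) | i < k].
have tE i : tnth t i = 'X_i - (i == p)%:R *: ((l@_U_(p))^-1 *: l).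
  by rewrite tnth_mktuple.
have sl : l \mPo t = 0.
  rewrite {1}(linear_formE l hl) raddf_sum /=.
  under eq_bigr => i _ do rewrite comp_mpolyZ comp_mpolyXU -tnth_nth tE scalerBr.
  rewrite sumrB -linear_formE // (bigD1 p) //= eqxx scale1r scalerA divff //.
  rewrite scale1r big1 ?addr0 ?subrr // => i ip.
  by rewrite (negPf ip) scale0r scaler0.
have sd : forall f, exists c, f - (f \mPo t) = c * l.
  apply: comp_mpoly_congr => i; exists ((i == p)%:R * (l@_U_(p))^-1)%:MP.
  by rewrite tE subKr mul_mpolyC scalerA.
exists (comp_mpoly t) => f; split=> [s0|[c ->]].
  by have [c] := sd f; rewrite s0 subr0 => ->; exists c.
by rewrite rmorphM /= sl mulr0.
Qed.

End LinearForms.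

(** * Syzygies of cofactors of primes *)

(** The endomorphism [s i] stands for reduction modulo [p i]: it makes [p i]
    prime, as [R] is a domain.  Modulo [p i] every cofactor but the [i]-th
    vanishes, and the [i]-th does not. *)
Lemma syzygies_of_cofactors {R : idomainType} {m : nat} {Q : R}
    {p : 'I_m -> R} {s : 'I_m -> {rmorphism R -> R}} (a : 'I_m -> R) :
  Q != 0 -> (forall i, p i != 0) ->
  (forall i f, s i f = 0 <-> exists c, f = c * p i) ->
  (forall i j, j != i -> s i (p j) != 0) ->
  \sum_i a i * (Q * \prod_(j | j != i) p j) = 0 ->
  exists b : 'I_m -> R, (forall i, a i = b i * p i) /\ \sum_i b i = 0.
Proof.
move=> Q0 p0 sE sep sum0.
have sum0' : \sum_i a i * \prod_(j | j != i) p j = 0.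
  apply: (mulfI Q0); rewrite mulr0 mulr_sumr -[RHS]sum0.
  by apply: eq_bigr => i _; rewrite mulrCA.
have adiv i : exists c, a i = c * p i.
  apply/sE; move: (congr1 (s i) sum0'); rewrite rmorph0 rmorph_sum (bigD1 i) //=.
  rewrite [X in _ + X]big1 => [|j ji]; last first.
    rewrite rmorphM rmorph_prod (bigD1 i) 1?eq_sym //=.
    by rewrite (_ : s i (p i) = 0) ?mul0r ?mulr0 //; apply/sE; exists 1; rewrite mul1r.
  rewrite addr0 rmorphM rmorph_prod => /eqP; rewrite mulf_eq0 => /orP[/eqP //|].
  by move/prodf_eq0 => [j ji]; rewrite (negPf (sep _ _ ji)).
have [b bE] := fin_all_exists adiv; exists b; split=> //.
have P0 : \prod_j p j != 0 by apply/prodf_neq0.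
apply: (mulIf P0); rewrite mul0r mulr_suml -[RHS]sum0'.
by apply: eq_bigr => i _; rewrite [in LHS](bigD1 i) //= bE mulrA.
Qed.

(** * Representatives of a finite preorder *)

(** A minimal subset of the indices that dominates all of them has no two
    comparable elements: the smaller one could be dropped. *)
Lemma maximal_representatives {n : nat} (d : rel 'I_n) :
  reflexive d -> transitive d -> (0 < n)%N ->
  exists m (e : 'I_m.+1 -> 'I_n),
    (forall i, exists a, d i (e a)) /\ (forall a b, b != a -> ~~ d (e a) (e b)).
Proof.
move=> dr dt n0.
pose covers (T : {set 'I_n}) := [forall i, [exists t in T, d i t]].
have [|T /minsetP[/forallP cT minT]] := @ex_minset _ covers.
  by exists setT; apply/forallP=> i; apply/existsP; exists i; rewrite inE dr.
have T0 : (0 < #|T|)%N.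
  by have /exists_inP[t tT _] := cT (Ordinal n0); apply/card_gt0P; exists t.
exists #|T|.-1, (fun a => enum_val (cast_ord (prednK T0) a)); split=> [i|a b ba].
  have /exists_inP[t tT it] := cT i.
  by exists (cast_ord (esym (prednK T0)) (enum_rank_in tT t)); rewrite cast_ordKV enum_rankK_in.
set x := enum_val _; set y := enum_val _.
have xy : x != y by rewrite (inj_eq enum_val_inj) (inj_eq (@cast_ord_inj _ _ _)) eq_sym.
apply/negP => dxy.
have xT : x \in T by apply: enum_valP.
suff /minT/(_ (subsetDl _ _)) eT : covers (T :\ x) by rewrite -eT !inE eqxx in xT.
apply/forallP=> i; have /exists_inP[t tT it] := cT i.
apply/exists_inP; have [tx|tx] := eqVneq t x; last by exists t; rewrite // !inE tx.
exists y; first by rewrite !inE eq_sym xy enum_valP.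
by rewrite tx in it; apply: dt dxy.
Qed.

(** * The Hilbert-Burch matrix *)

Definition linear_form_on_rows {R : comNzRingType} {m : nat} (g : 'I_m -> R)
  (u : 'rV[R]_m) : R^o := \sum_i u 0 i * g i.

Lemma linear_form_on_rows_is_linear {R : comNzRingType} {m : nat} (g : 'I_m -> R) :
  linear (linear_form_on_rows g).
Proof.
move=> c u v; rewrite /linear_form_on_rows scaler_sumr -big_split /=.
by apply: eq_bigr => i _; rewrite !mxE mulrDl -[c * _ * _]mulrA.
Qed.

HB.instance Definition _ (R : comNzRingType) (m : nat) (g : 'I_m -> R) :=
  GRing.isLinear.Build R 'rV[R]_m R^o *:%R (linear_form_on_rows g)
    (linear_form_on_rows_is_linear g).

(** The rows are [p_i e_i - p_m e_m], [i < m]. *)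
Definition hilbert_burch_matrix {R : comNzRingType} {m : nat} (p : 'I_m.+1 -> R) :
    'M[R]_(m, m.+1) :=
  \matrix_(i, j) (if (j : nat) == i then p j
                  else if (j : nat) == m then - p j else 0).

(** The coordinates of a vector [w], completed by minus their sum, are the
    coefficients of the [p j] in its image. *)
Lemma hilbert_burch_matrixE {R : comNzRingType} {m : nat} (p : 'I_m.+1 -> R)
    (w : 'rV[R]_m) (j : 'I_m.+1) :
  (w *m hilbert_burch_matrix p) 0 j =
  (if unlift ord_max j is Some i then w 0 i else - \sum_i w 0 i) * p j.
Proof.
rewrite mxE; case: unliftP => [i ->|->].
  rewrite (bigD1 i) //= big1 ?addr0 => [|a ai].
    by rewrite mxE lift_max eqxx.
  by rewrite mxE lift_max /= (ltn_eqF (ltn_ord i)) eq_sym val_eqE (negPf ai) mulr0.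
rewrite mulNr mulr_suml -sumrN; apply: eq_bigr => i _.
by rewrite mxE /= eqxx (gtn_eqF (ltn_ord i)) mulrN.
Qed.

Lemma hilbert_burch_matrix_inj {R : idomainType} {m : nat} (p : 'I_m.+1 -> R)
    (w : 'rV[R]_m) :
  (forall i, p i != 0) -> w *m hilbert_burch_matrix p = 0 -> w = 0.
Proof.
move=> p0 w0; apply/rowP=> i; move/rowP/(_ (lift ord_max i)): w0.
rewrite hilbert_burch_matrixE liftK !mxE => /eqP.
by rewrite mulf_eq0 (negPf (p0 _)) orbF => /eqP.
Qed.

Lemma hilbert_burch_matrix_image {R : comNzRingType} {m : nat} (p : 'I_m.+1 -> R)
    (v : 'rV[R]_m.+1) :
  (exists w : 'rV[R]_m, w *m hilbert_burch_matrix p = v) <->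
  (exists b : 'I_m.+1 -> R, (forall j, v 0 j = b j * p j) /\ \sum_j b j = 0).
Proof.
split=> [[w <-]|[b [vE b0]]].
  eexists; split; first by move=> j; apply: hilbert_burch_matrixE.
  rewrite (bigD1_ord ord_max) //= unlift_none.
  rewrite [X in _ + X](eq_bigr (fun i => w 0 i)) ?addNr // => i _.
  by rewrite liftK.
exists (\row_i b (lift ord_max i)); apply/rowP=> j; rewrite hilbert_burch_matrixE vE.
congr (_ * _); case: unliftP => [i ->|->]; first by rewrite mxE.
under eq_bigr => i _ do rewrite mxE.
by apply/esym/eqP; rewrite -addr_eq0 -[X in _ == X]b0 (bigD1_ord ord_max).
Qed.

(** * Graded maps and the linear resolution *)

Section Graded.
Context {K : fieldType} {k : nat}.
Local Notation R := {mpoly K[k]}.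

Lemma dhomog_prod_card {I : finType} (A : {pred I}) (F : I -> R) :
  (forall i, F i \is 1.-homog) -> \prod_(i in A) F i \is #|A|.-homog.
Proof.
move=> h; rewrite -sum1_card.
by apply: (big_rec2 (fun x d => x \is d.-homog)) => [|i d x _ hx];
  [apply: dhomog1 | apply: dhomogM].
Qed.

Lemma graded_linear_form_on_rows {m d : nat} (g : 'I_m -> R) :
  (forall i, g i \is d.-homog) ->
  graded_map (@twisted_homog K k m d) (fun e (f : R) => f \is e.-homog)
    (linear_form_on_rows g).
Proof.
move=> gh e u; rewrite /twisted_homog /linear_form_on_rows.
case: leqP => [de uh|_ ->].
  by apply: rpred_sum => i _; have := dhomogM (uh i) (gh i); rewrite subnK.
by rewrite big1 ?dhomog0 // => i _; rewrite mxE mul0r.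
Qed.

Lemma graded_mulmxr {m' m s : nat} (M : 'M[R]_(m', m)) :
  (forall i j, M i j \is 1.-homog) ->
  graded_map (@twisted_homog K k m' s.+1) (@twisted_homog K k m s) (mulmxr M).
Proof.
move=> Mh e u; rewrite /twisted_homog /=.
case: (ltnP s e) => [se uh|_ ->]; last first.
  by rewrite mul0mx; case: ifP => // _ j; rewrite mxE dhomog0.
rewrite ltnW // => j; rewrite mxE; apply: rpred_sum => i _.
by have := dhomogM (uh i) (Mh i j); rewrite addn1 subnSK.
Qed.

(** Ranks and matrices are indexed by all of [nat]: beyond the two terms of the
    resolution the modules are zero. *)
Definition two_term_ranks (m i : nat) : nat :=
  match i with 0 => m.+1 | 1 => m | _ => 0 end.

Definition two_term_matrix {m : nat} (p : 'I_m.+1 -> R) (i : nat) :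
    'M[R]_(two_term_ranks m i.+1, two_term_ranks m i) :=
  match i with 0 => hilbert_burch_matrix p | _ => 0 end.

(** Generators whose syzygies are the [(b_j p_j)] with [\sum_j b_j = 0], for
    linear forms [p_j], are resolved by the Hilbert-Burch matrix. *)
Lemma hilbert_burch_linear_resolution {m d : nat} {I : R -> Prop}
    (g p : 'I_m.+1 -> R) :
  generated_in_degree d I ->
  (forall i, g i \is d.-homog) ->
  (forall i, p i \is 1.-homog) -> (forall i, p i != 0) ->
  (forall f, I f <-> exists u, linear_form_on_rows g u = f) ->
  (forall v, linear_form_on_rows g v = 0 <->
     exists b : 'I_m.+1 -> R, (forall j, v 0 j = b j * p j) /\ \sum_j b j = 0) ->
  has_linear_resolution d I.
Proof.
move=> genI gh ph p0 Ig syz; split=> //.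
exists 1%N, (two_term_ranks m), (linear_form_on_rows g : {linear _ -> _}),
  (fun i => mulmxr (two_term_matrix p i)).
split=> //; split; first by case=> [|[]].
split; first exact: graded_linear_form_on_rows.
split.
  move=> i; rewrite addnS; apply: graded_mulmxr => a b.
  case: i a b => [|i] a b; last by rewrite mxE dhomog0.
  rewrite mxE; case: ifP => _; first exact: ph.
  by case: ifP => _; rewrite ?dhomog0 // dhomogN; apply: ph.
split=> //; split=> [v|i v].
  split=> [/syz/(hilbert_burch_matrix_image p v)[w]|[w <-]]; first by exists w.
  by apply/syz/hilbert_burch_matrix_image; exists w.
have triv : (exists u, mulmxr (two_term_matrix p i.+1) u = v) <-> v = 0.
  split=> [[u <-]|->]; first by rewrite /= mulmx0.
  by exists 0; rewrite /= mul0mx.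
split=> [v0|/triv ->]; last by rewrite /= mul0mx.
apply/triv; case: i v v0 triv => [|i] v v0 _; first exact: hilbert_burch_matrix_inj v0.
by apply/rowP => -[].
Qed.

End Graded.

Lemma setC1_of_card {T : finType} (A : {set T}) :
  (0 < #|T|)%N -> #|A| = #|T|.-1 -> exists i, A = [set~ i].
Proof.
move=> T0 cA; have /cards1P[i iE] : #|~: A| == 1%N.
  by rewrite -(eqn_add2l #|A|) cardsC cA addn1 prednK.
by exists i; rewrite -iE setCK.
Qed.


(** * The ideal of the products of all forms but one *)

Theorem mainTheorem3 (K : fieldType) (k n : nat) (l : n.-tuple {mpoly K[k]})
  (charK0 : [pchar K] =i pred0)
  (n_gt0 : (0 < n)%N)
  (l_linear : forall i : 'I_n, tnth l i \is 1.-homog)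
  (l_neq0 : forall i : 'I_n, tnth l i != 0) :
  has_linear_resolution n.-1 (fold_product_ideal l n.-1).
Proof.
have [s sE] := fin_all_exists (fun i => linear_form_kernel (tnth l i) (l_linear i) (l_neq0 i)).
(* [d i j] is divisibility of the [j]-th form by the [i]-th, made decidable. *)
pose d (i j : 'I_n) := s i (tnth l j) == 0.
have dP i j : reflect (exists c, tnth l j = c * tnth l i) (d i j).
  by apply: (iffP eqP) => /sE.
have dr : reflexive d by move=> i; apply/dP; exists 1; rewrite mul1r.
have dt : transitive d.
  move=> j i h /dP[c ec] /dP[c' ec']; apply/dP; exists (c' * c).
  by rewrite ec' ec mulrA.
have [m [e [cover sep]]] := maximal_representatives d dr dt n_gt0.
have e_inj : injective e.
  move=> a b eab; apply/eqP/negPn/negP => ab.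
  by have := sep b a ab; rewrite eab dr.
pose G i := \prod_(j in [set~ i]) tnth l j.
have GE i : tnth l i * G i = \prod_j tnth l j.
  by rewrite [RHS](bigD1 i) //=; congr (_ * _); apply: eq_bigl => j; rewrite !inE.
have Gh i : G i \is n.-1.-homog.
  by rewrite -[n in n.-1]card_ord -(cardsC1 i); apply: dhomog_prod_card.
pose p a := tnth l (e a).
pose Q := \prod_(j | j \notin codom e) tnth l j.
have Q0 : Q != 0 by apply/prodf_neq0.
have GQ a : G (e a) = Q * \prod_(b | b != a) p b.
  apply: (mulfI (l_neq0 (e a))); rewrite GE mulrCA.
  have <- : \prod_b p b = p a * \prod_(b | b != a) p b by rewrite (bigD1 a).
  rewrite (bigID (mem (codom e))) /= mulrC; congr (_ * _).
  have cU : uniq (codom e) by rewrite map_inj_uniq ?enum_uniq.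
  by rewrite -(big_uniq _ cU) big_image.
apply: (hilbert_burch_linear_resolution (fun a => G (e a)) p).
- exists (fun g => exists2 A : {set 'I_n}, #|A| = n.-1 & g = \prod_(i in A) tnth l i).
  by split=> [g [A <- ->]|]; [apply: dhomog_prod_card | ].
- by move=> a; apply: Gh.
- by move=> a; apply: l_linear.
- by move=> a; apply: l_neq0.
- move=> f; split=> [[N [c [g [gS ->]]]]|[u <-]]; last first.
    exists m.+1, (fun a => u 0 a), (fun a => G (e a)); split=> // a.
    by exists [set~ e a]; rewrite // cardsC1 card_ord.
  have gu i : exists u, linear_form_on_rows (fun a => G (e a)) u = g i.
    have [A cA ->] := gS i.
    have [|h ->] := setC1_of_card A _ (etrans cA (congr1 predn (esym (card_ord n)))).
      by rewrite card_ord.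
    (* [l_(e a) = x l_h] gives [G h = x G (e a)], as [l_i G i] does not depend on [i]. *)
    have [a /dP[x ex]] := cover h; exists (x *: delta_mx 0 a).
    rewrite linearZ /= /linear_form_on_rows (bigD1 a) //= big1 => [|b ba].
      rewrite mxE !eqxx mul1r addr0; apply: (mulfI (l_neq0 h)).
      by rewrite [RHS]GE -(GE (e a)) ex mulrCA mulrA.
    by rewrite mxE (negPf ba) andbF mul0r.
  have [U UE] := fin_all_exists gu; exists (\sum_i c i *: U i).
  by rewrite linear_sum; apply: eq_bigr => i _; rewrite linearZ /= UE.
- move=> v; rewrite /linear_form_on_rows; under eq_bigr => a _ do rewrite GQ.
  split=> [v0|[b [vE b0]]].
    apply: (syzygies_of_cofactors _ Q0 _ _ _ v0) => [a|a f|a b]; first exact: l_neq0.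
      exact: sE.
    exact: sep.
  under eq_bigr => a _ do rewrite vE -GQ -mulrA GE.
  by rewrite -mulr_suml b0 mul0r.
Qed.
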